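(* Let $k\ge 0$ be a fixed integer and let $p=p(n)$ satisfy $p=o(1)$ as $n\to\infty$. Let $R$ be a random subset of the cyclic group $C_n$ obtained by choosing each element of $C_n$ independently with probability $p$, and let $N^R_{n-1-k}$ be the number of zero-sum free sequences of length $n-1-k$ contained in $R$. Then $$\mathbb E\left(N^R_{n-1-k}\right)=p\,\varphi(n)\left(1+O_k(p)\right)\qquad (n\to\infty),$$ where the constant in $O_k$ depends only on $k$ and $\varphi(n)$ denotes the number of generators of $C_n$.
   Context: $C_n$ is the cyclic group of order $n$, written additively. A sequence of length $\ell$ over $C_n$ is an unordered collection with repetition allowed (a multiset) $S=a_1\cdot a_2\cdot\ldots\cdot a_\ell$ of $\ell$ elements of $C_n$. A subsequence of $S$ is a sequence $T$ in which the multiplicity of each $a\in C_n$ is at most its multiplicity in $S$. $S$ is a zero-sum sequence if $a_1+\dots+a_\ell=0$, and $S$ is zero-sum free if it contains no (nonempty) zero-sum subsequence. $S$ is contained in $A\subset C_n$ if every element occurring in $S$ lies in $A$. *)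

(* Defs.v *)
From HB Require Import structures.
From mathcomp Require Export all_boot all_order all_algebra all_fingroup.
From mathcomp Require Export cyclic.
From mathcomp Require Export finmap multiset.
From mathcomp Require Export all_classical all_reals all_analysis.
Export Order.TTheory GRing.Theory Num.Theory numFieldNormedType.Exports.

Set Implicit Arguments.
Unset Strict Implicit.
Unset Printing Implicit Defensive.

Local Open Scope classical_set_scope.
Local Open Scope ring_scope.

(* 'Z_n is the ring of integers modulo n only for 1 < n: 'Z_0 and 'Z_1 are
   both Z/2Z. *)

Section Sequences.
Variable n : nat.

(* Sequences over C_n are unordered, hence multisets; the length of
   S : {mset 'Z_n} is size S, via the coercion enumerating S with
   multiplicities, and T `<=` S in %mset compares multiplicities. *)

Definition zero_sum (S : {mset 'Z_n}%mset) : Prop := \sum_(a <- S) a = 0.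

Definition zero_sum_free (S : {mset 'Z_n}%mset) : Prop :=
  forall T : {mset 'Z_n}%mset,
    T != mset0 -> (T `<=` S)%mset -> ~ zero_sum T.

Definition zero_sum_free_in (l : nat) (A : {set 'Z_n}) :
    set {mset 'Z_n}%mset :=
  [set S : {mset 'Z_n}%mset | [/\ size S = l, zero_sum_free S & {subset S <= A}]].

(* fset_set is the empty set on infinite sets: this makes num_zero_sum_free
   the true cardinality. *)
Lemma finite_zero_sum_free_in l A : finite_set (zero_sum_free_in l A).
Proof.
pose f (t : l.-tuple 'Z_n) := seq_mset t.
apply: (@sub_finite_set _ _ (f @` [set: l.-tuple 'Z_n])).
  move=> S [sS _ _]; exists (tcast sS (in_tuple S)) => //.
  by rewrite /f val_tcast seq_mset_id.
exact: finite_image.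
Qed.

Definition num_zero_sum_free (l : nat) (A : {set 'Z_n}) : nat :=
  #|` fset_set (zero_sum_free_in l A)|.

Definition num_generators : nat :=
  #|[set g : 'Z_n | generator [set: 'Z_n] g]%SET|.

End Sequences.

Section Random.
Context d (Om : measurableType d) (R : realType) (P : probability Om R).

Definition independent_events (I : finType) (E : I -> set Om) : Prop :=
  (forall i, measurable (E i)) /\
  forall J : {set I},
    P (\bigcap_(i in [set` J]) E i) = (\prod_(i in J) P (E i))%E.

Definition random_subset (T : finType) (p : R) (X : Om -> {set T}) : Prop :=
  independent_events (fun a => [set w | a \in X w]) /\
  forall a, P [set w | a \in X w] = p%:E.

End Random.

(* Main.v *)
(** The expectation is the sum of [p ^ #|supp S|] over the zero-sum free [S] of
    length [n-1-k]. Those with one-element support are the powers of the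
    generators and contribute exactly [p * phi(n)]; each of the others
    contributes at most [p^2], so it suffices that there are [O_k(phi(n))] of
    them. By Scherk's theorem the set of subsums of a zero-sum free sequence
    grows by at least 1 with each element, and by at least 3 with each pair of
    distinct elements; as there are at most [n] subsums, at most [k] disjoint
    such pairs can be split off. So [S] is a power [g^m] with [m >= n-1-3k] times
    at most [2k] further elements. For large [n], [g] is a generator, and the
    other elements are [j g] with [j <= 3k+1], since [- j g] is not among the
    multiples [0, g, .., m g]. *)
Require Import Defs.
From mathcomp Require Import zify ring measurable_realfun.

Set Implicit Arguments.
Unset Strict Implicit.
Unset Printing Implicit Defensive.

Local Open Scope classical_set_scope.
Local Open Scope ring_scope.

(** * Scherk's theorem on sumsets in a finite abelian group *)

Section Sumsets.
Variable G : finZmodType.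
Implicit Types (A B : {set G}) (g x : G) (s t u : seq G).

Definition sumset A B : {set G} := [set a + b | a in A, b in B]%SET.

(* For [b != 0] in [B] some [e \in A] has [b + e \notin A]; the Dyson transform
   [(A :|: (B + e), B :&: (A - e))] then removes [b] from [B] while preserving
   the hypotheses and [#|A| + #|B|]. *)
Lemma scherk A B : 0 \in A -> 0 \in B ->
  (forall a b, a \in A -> b \in B -> a + b = 0 -> a = 0) ->
  (#|A| + #|B| <= #|sumset A B|.+1)%N.
Proof.
have [m] := ubnP #|B|; elim: m A B => // m IH A B ltBm A0 B0 AB.
have [b /andP[/= bB b0]|B1] := pickP [pred b in B | b != 0]; last first.
  have -> : B = [set 0]%SET.
    apply/setP => x; rewrite inE; apply/idP/eqP => [xB|->//].
    by have /negbT := B1 x; rewrite /= xB negbK => /eqP.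
  rewrite cards1 addn1 ltnS; apply: subset_leq_card.
  apply/fintype.subsetP => x xA; rewrite -[x]addr0.
  by apply: imset2_f => //; rewrite inE.
have [e /andP[/= eA beA]|AbA] := pickP [pred e in A | b + e \notin A]; last first.
  (* Without such an [e], [b + A = A] contains 0, so [b + a = 0] for some [a] in [A]; the hypothesis
     gives [a = 0] and hence [b = 0]. *)
  have bAA : ((fun a => b + a) @: A)%SET = A.
    apply/eqP; rewrite eqEcard card_imset ?leqnn ?andbT; last exact: addrI.
    apply/fintype.subsetP => _ /imsetP[a aA ->].
    by have /negbT := AbA a; rewrite /= aA negbK.
  have := A0; rewrite -bAA => /imsetP[a aA /esym ba].
  have a0 := AB a b aA bB; move: ba; rewrite addrC => /[dup] /a0 ->.
  by rewrite add0r => b00; rewrite b00 eqxx in b0.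
pose A' := (A :|: (fun x => x + e) @: B)%SET.
pose B' := (B :&: (fun x => x + e) @^-1: A)%SET.
have cAB : (#|A'| + #|B'| = #|A| + #|B|)%N.
  have -> : #|B'| = #|A :&: (fun x => x + e) @: B|%SET.
    rewrite -(card_imset (mem B') (addIr e)); apply: eq_card => y.
    apply/imsetP/idP => [[x]|].
      by rewrite !inE => /andP[xB xA] ->; rewrite xA /=; apply: imset_f.
    rewrite inE => /andP[yA /imsetP[x xB yE]]; exists x => //.
    by rewrite !inE xB -yE.
  by rewrite cardsUI card_imset //; exact: addIr.
rewrite -cAB; apply: leq_trans (IH A' B' _ _ _ _) _.
- rewrite -ltnS (leq_trans _ ltBm)// ltnS; apply: proper_card.
  apply/properP; split; first by apply/fintype.subsetP => x; rewrite inE => /andP[].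
  by exists b => //; rewrite !inE (negbTE beA) andbF.
- by rewrite !inE A0.
- by rewrite !inE B0 add0r eA.
- move=> a' b'; rewrite !inE => /orP[aA|/imsetP[b1 b1B ->]] /andP[b'B b'A] ab0.
    exact: AB aA b'B ab0.
  (* Here [a' = b1 + e]. As [b' + e] is in [A] and [b1] in [B], the regrouped sum forces
     [b' + e = 0] and [b1 = 0]; then [e + b' = 0] forces [e = 0]. *)
  have h : (b' + e) + b1 = 0 by rewrite -ab0 addrC addrA addrAC.
  have b'e := AB _ _ b'A b1B h; rewrite b'e add0r in h.
  rewrite h add0r; apply: (AB _ b') => //; by rewrite addrC.
rewrite ltnS; apply: subset_leq_card; apply/fintype.subsetP => x.
move=> /imset2P[a' b']; rewrite !inE => /orP[aA|/imsetP[b1 b1B ->]] /andP[b'B b'A] ->.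
  exact: imset2_f.
by rewrite -addrA (addrC e) addrC; exact: imset2_f.
Qed.

(** * Subsums of zero-sum free sequences *)

Definition subsum s x := exists t u, perm_eq s (t ++ u) /\ x = \sum_(a <- t) a.

(** Lists up to permutation replace multisets, so that sequences can be cut and concatenated;
    [zero_sum_freeP] links this to [zero_sum_free]. *)
Definition zsf s := forall t u, perm_eq s (t ++ u) -> \sum_(a <- t) a = 0 -> t = [::].

Lemma zsf_perm s s' : perm_eq s s' -> zsf s -> zsf s'.
Proof. by move=> ss' zs t u s't; apply: (zs t u); exact: perm_trans s't. Qed.

Lemma zsf_catl s1 s2 : zsf (s1 ++ s2) -> zsf s1.
Proof.
by move=> zs t u s1t; apply: (zs t (u ++ s2)); rewrite catA perm_cat2r.
Qed.

Lemma zsf_nseq_mulrn g m j :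
  zsf (nseq m g) -> (0 < j <= m)%N -> g *+ j != 0.
Proof.
move=> zs /andP[j0 jm]; apply/eqP => gj0.
have := zs (nseq j g) (nseq (m - j) g).
rewrite -nseqD subnKC // => /(_ (perm_refl _)).
rewrite big_nseq iter_addr_0 => /(_ gj0).
by case: j j0 {jm gj0}.
Qed.

Lemma subsum_cat s1 s2 x1 x2 :
  subsum s1 x1 -> subsum s2 x2 -> subsum (s1 ++ s2) (x1 + x2).
Proof.
move=> [t1 [u1 [p1 ->]]] [t2 [u2 [p2 ->]]]; exists (t1 ++ t2), (u1 ++ u2).
rewrite big_cat; split=> //; apply: perm_trans (perm_cat p1 p2) _.
by rewrite -!catA perm_cat2l perm_catCA.
Qed.

Lemma subsum_perm s s' x : perm_eq s s' -> subsum s x -> subsum s' x.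
Proof.
move=> ss' [t [u [st xt]]]; exists t, u; split=> //.
by rewrite perm_sym in ss'; exact: perm_trans st.
Qed.

(** The two subsequences together have sum 0, so both are empty and [x1] is an empty sum. This is
    the hypothesis of [scherk] for sets of subsums. *)
Lemma zsf_subsum_cat s1 s2 x1 x2 : zsf (s1 ++ s2) ->
  subsum s1 x1 -> subsum s2 x2 -> x1 + x2 = 0 -> x1 = 0.
Proof.
move=> zs [t1 [u1 [p1 ->]]] [t2 [u2 [p2 ->]]] t0.
have/(zs (t1 ++ t2) (u1 ++ u2)) : perm_eq (s1 ++ s2) ((t1 ++ t2) ++ (u1 ++ u2)).
  apply: perm_trans (perm_cat p1 p2) _.
  by rewrite -!catA perm_cat2l perm_catCA.
by rewrite big_cat => /(_ t0); case: t1 {p1 t0} => //; rewrite big_nil.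
Qed.

(** Scherk's theorem needs 0 in [A]. Its loss of 1 is absorbed by the strict bound, which makes [m]
    additive under concatenation. *)
Definition many_subsums s m :=
  exists A : {set G}, [/\ 0 \in A, forall x, x \in A -> subsum s x & (m < #|A|)%N].

Lemma many_subsums_cat s1 s2 m1 m2 : zsf (s1 ++ s2) ->
  many_subsums s1 m1 -> many_subsums s2 m2 -> many_subsums (s1 ++ s2) (m1 + m2).
Proof.
move=> zs [A1 [A10 A1s m1A]] [A2 [A20 A2s m2A]]; exists (sumset A1 A2); split.
- by rewrite -[0]addr0; apply: imset2_f.
- by move=> x /imset2P[a b aA bA ->]; apply: subsum_cat; [exact: A1s|exact: A2s].
have: (#|A1| + #|A2| <= #|sumset A1 A2|.+1)%N.
  by apply: scherk => // a b aA bA; apply: (zsf_subsum_cat zs); [exact: A1s|exact: A2s].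
lia.
Qed.

Lemma many_subsums1 g : zsf [:: g] -> many_subsums [:: g] 1.
Proof.
move=> zs; exists [set 0; g]%SET; split; rewrite ?set21//.
  move=> x /set2P[->|->]; first by exists [::], [:: g]; rewrite big_nil.
  by exists [:: g], [::]; rewrite big_seq1.
rewrite cards2; case: eqVneq => // /esym g0.
by have := zs [:: g] [::]; rewrite big_seq1 => /(_ (perm_refl _) g0).
Qed.

Lemma many_subsums_nseq g m : zsf (nseq m g) -> many_subsums (nseq m g) m.
Proof.
elim: m => [_|m IH zs].
  exists [set 0]%SET; rewrite set11 cards1; split=> // x /set1P ->.
  by exists [::], [::]; rewrite big_nil.
change (zsf ([:: g] ++ nseq m g)) in zs.
apply: (@many_subsums_cat [:: g] (nseq m g) 1 m) => //.
  exact/many_subsums1/zsf_catl/zs.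
by apply/IH/(@zsf_catl _ [:: g])/zsf_perm/zs; rewrite perm_catC.
Qed.

(** The subsums 0, [a], [b], [a + b] are distinct: one more than two separate elements would
    guarantee. *)
Lemma many_subsums2 a b : a != b -> zsf [:: a; b] -> many_subsums [:: a; b] 3.
Proof.
move=> ab zs.
have zab : zsf [:: b; a] by apply: zsf_perm zs; rewrite (perm_catC [:: a] [:: b]).
have nz c c' : zsf [:: c; c'] -> c != 0.
  move=> z; apply/eqP => c0.
  by have := z [:: c] [:: c'] (perm_refl _); rewrite big_seq1 => /(_ c0).
have a0 := nz _ _ zs; have b0 := nz _ _ zab.
have ab0 : a + b != 0.
  apply/eqP => h; have := zs [:: a; b] [::] (perm_refl _).
  by rewrite !big_cons big_nil addr0 => /(_ h).
exists [set x in [:: 0; a; b; a + b]]%SET; split; first by rewrite inE mem_head.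
  move=> x; rewrite !inE => /or4P[] /eqP ->.
  - by exists [::], [:: a; b]; rewrite big_nil.
  - by exists [:: a], [:: b]; rewrite big_seq1.
  - by exists [:: b], [:: a]; rewrite big_seq1 (perm_catC [:: a] [:: b]).
  - by exists [:: a; b], [::]; rewrite !big_cons big_nil addr0.
rewrite cardsE; have /card_uniqP -> // : uniq [:: 0; a; b; a + b].
rewrite /= !inE !negb_or ab !(eq_sym 0) a0 b0 ab0 /=.
by rewrite -{1}[a]addr0 (inj_eq (addrI a)) eq_sym b0 -{1}[b]add0r (inj_eq (addIr b)) eq_sym a0.
Qed.

Lemma pairs_or_const s : s != [::] ->
  (exists g, s = nseq (size s) g) \/
  (exists a b s', a != b /\ perm_eq s ([:: a; b] ++ s')).
Proof.
case: s => // g s _; have [h|] := boolP (all (pred1 g) s).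
  by left; exists g => /=; rewrite -(all_pred1P _ _ h).
move=> /allPn[h hs hg]; right; exists g, h, (rem h s); rewrite eq_sym; split=> //.
by rewrite /= perm_cons perm_to_rem.
Qed.

Lemma zsf_decomp s : zsf s -> exists q g s',
  [/\ perm_eq s (nseq (size s - q.*2) g ++ s'), size s' = q.*2 &
      many_subsums s (size s + q)].
Proof.
have [m] := ubnP (size s); elim: m s => // m IH s ltsm zs.
have [s00|s0] := eqVneq s [::].
  rewrite {}s00 in zs *.
  by exists 0%N, 0, [::]; split=> //; exact: (@many_subsums_nseq 0 0%N).
have [[g sg]|[a [b [s1 [ab ss1]]]]] := pairs_or_const s0.
  exists 0%N, g, [::]; rewrite subn0 cats0 -sg addn0; split=> //.
  by move: zs; rewrite sg size_nseq; exact: many_subsums_nseq.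
have zs1 := zsf_perm ss1 zs.
have szs := perm_size ss1; rewrite size_cat/= in szs.
have [||q [g [s' [p1 ss' M]]]] := IH s1.
- lia.
- by apply: zsf_catl; apply: zsf_perm zs1; rewrite perm_catC.
exists q.+1, g, ([:: a; b] ++ s'); split.
- apply: perm_trans ss1 _; rewrite perm_sym perm_catCA perm_cat2l perm_sym.
  by have -> : (size s - q.+1.*2 = size s1 - q.*2)%N by lia.
- by rewrite /= ss'; lia.
have [A [A0 As cA]] : many_subsums ([:: a; b] ++ s1) (3 + (size s1 + q)).
  by apply: many_subsums_cat => //; apply: many_subsums2 => //; exact: zsf_catl zs1.
exists A; split=> //; last lia.
by move=> x /As; apply: subsum_perm; rewrite perm_sym.
Qed.

End Sumsets.

Lemma zero_sum_freeP n (S : {mset 'Z_n}%mset) : zero_sum_free S <-> zsf (S : seq 'Z_n).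
Proof.
split=> [zS t u St t0|zS T T0 TS zT].
  have [//|tn] := eqVneq t [::]; exfalso; apply: (zS (seq_mset t)).
  - rewrite -size_mset_eq0 (perm_size (perm_eq_seq_mset t)).
    by rewrite size_eq0.
  - apply/msubsetP => x; rewrite mset_seqE -count_mem_mset (seq.permP St).
    by rewrite count_cat leq_addr.
  - by rewrite /zero_sum (perm_big _ (perm_eq_seq_mset t)).
have /(zS (T : seq _))/(_ zT) T00 : perm_eq (S : seq 'Z_n) ((T : seq _) ++ (S `\` T)%mset).
  apply/allP => x _ /=; rewrite count_cat !count_mem_mset.
  have /msubsetP/(_ x) := TS.
  by rewrite msetE2 eqn_leq; lia.
by move: T0; rewrite -size_mset_eq0 T00.
Qed.

(** * Structure and number of the long zero-sum free sequences over the cyclic group *)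

Section CyclicStructure.
Variable n : nat.
Hypothesis n_gt1 : (1 < n)%N.
Implicit Types (g : 'Z_n) (s : seq 'Z_n).

Lemma card_Zn : #|'Z_n| = n.
Proof. by rewrite card_ord Zp_cast. Qed.

Lemma order_generator g : generator [set: 'Z_n]%SET g -> #[g]%g = n.
Proof. by move=> /eqP gT; rewrite orderE -gT cardsT card_Zn. Qed.

(** The order of [g] divides [n] and exceeds [m], which is at least [n / 2], so it equals [n]. *)
Lemma zsf_generator g m : (n <= m.*2)%N -> zsf (nseq m g) -> generator [set: 'Z_n]%SET g.
Proof.
move=> nm zs; have mo : (m < #[g]%g)%N.
  rewrite ltnNge; apply/negP => om.
  have /(zsf_nseq_mulrn zs)/eqP[] : (0 < #[g]%g <= m)%N by rewrite order_gt0.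
  exact: (expg_order g).
have /dvdnP[q nq] : (#[g]%g %| n)%N.
  by rewrite -[X in (_ %| X)%N]card_Zn -cardsT; apply: order_dvdG; rewrite inE.
rewrite /generator eq_sym eqEcard finset.subsetT cardsT card_Zn -orderE /=.
case: q nq => [|[|q]] nq; nia.
Qed.

Lemma generator_zsf g m : generator [set: 'Z_n]%SET g -> (m < n)%N -> zsf (nseq m g).
Proof.
move=> /order_generator gn mn t u p t0.
have tE : t = nseq (size t) g.
  apply/all_pred1P/allP => x xt; have : x \in nseq m g.
    by rewrite (perm_mem p) mem_cat xt.
  by rewrite mem_nseq => /andP[].
have := perm_size p; rewrite size_nseq size_cat => sz.
move: t0; rewrite tE big_nseq iter_addr_0 => gt0.
have : (g ^+ size t == 1)%g by apply/eqP.
rewrite -order_dvdn gn; have [-> //|t_gt0] := posnP (size t).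
by rewrite gtnNdvd // (leq_ltn_trans _ mn) // sz leq_addr.
Qed.

Lemma zsf_structure k s : ((8 * k).+2 <= n)%N -> size s = (n - 1 - k)%N -> zsf s ->
  exists g (t : (k.*2).-tuple 'I_(3 * k).+2), generator [set: 'Z_n]%SET g /\
    perm_eq s (nseq (n - 1 - k - k.*2) g ++ [seq g *+ i | i : 'I_(3 * k).+2 <- t]).
Proof.
move=> kn ss zs.
have [q [g [s' [p1 ss' [A [_ _ cA]]]]]] := zsf_decomp zs.
(* There are more than [n - 1 - k + q] subsums, and at most [n]. *)
have qk : (q <= k)%N.
  have := leq_trans cA (max_card (mem A)); rewrite card_Zn ss; lia.
set m := (_ - _)%N in p1; have zp := zsf_perm p1 zs.
have gg : generator [set: 'Z_n]%SET g.
  by apply: (@zsf_generator _ m); [rewrite /m ss; lia | exact: zsf_catl zp].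
have small x : x \in s' -> exists i : 'I_(3 * k).+2, x == g *+ i.
  move=> xs'; have /cyclePmin[j] : x \in <[g]>%g by rewrite -(eqP gg) inE.
  rewrite order_generator // => jn; rewrite -[(g ^+ j)%g]/(g *+ j) => xE.
  suff jk : (j < (3 * k).+2)%N by exists (Ordinal jk); rewrite xE.
  (* If [j >= 3k + 2], then [n - j < n - 1 - 3k <= m], so [x] and [n - j] copies of [g] form a
     subsequence with sum [n g = 0]. *)
  rewrite ltnNge; apply/negP => kj.
  have := zp (x :: nseq (n - j) g) (nseq (m - (n - j)) g ++ rem x s').
  have gn0 : g *+ n = 0 by have := expg_order g; rewrite order_generator.
  have xn0 : x + g *+ (n - j) = 0 by rewrite xE -mulrnDr subnKC // ltnW.
  rewrite big_cons big_nseq iter_addr_0 => h.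
  suff /h/(_ xn0) : perm_eq (nseq m g ++ s')
    ((x :: nseq (n - j) g) ++ nseq (m - (n - j)) g ++ rem x s') by [].
  rewrite cat_cons catA -nseqD subnKC; last by rewrite /m ss; lia.
  apply: (@perm_trans _ (nseq m g ++ x :: rem x s')).
    by rewrite perm_cat2l perm_to_rem.
  by rewrite -cat1s perm_catCA.
(* By [small], the default [ord0] is never taken on [s']. *)
pose f x : 'I_(3 * k).+2 := odflt ord0 [pick i : 'I_(3 * k).+2 | x == g *+ i].
have s'E : s' = [seq g *+ i | i : 'I_(3 * k).+2 <- [seq f x | x <- s']].
  rewrite -map_comp -[LHS]map_id; apply/eq_in_map => x /small[i xi] /=.
  by rewrite /f; case: pickP => [j /eqP //|/(_ i)]; rewrite xi.
(* Coefficient 1 stands for [g] itself: moving [2(k - q)] copies of [g] into the tuple makes its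
   length [2k], whatever [q] is. *)
pose i1 : 'I_(3 * k).+2 := Ordinal (isT : (1 < (3 * k).+2)%N).
pose t := nseq (k.*2 - q.*2) i1 ++ [seq f x | x <- s'].
have st : size t == k.*2 by rewrite size_cat size_nseq size_map ss'; lia.
exists g, (Tuple st); split=> //=; rewrite map_cat -s'E map_nseq catA.
rewrite mulr1n -nseqD.
by have -> : (n - 1 - k - k.*2 + (k.*2 - q.*2) = m)%N by rewrite /m ss; lia.
Qed.

Definition all_zsf l := fset_set (zero_sum_free_in l [set: 'Z_n]%SET).

Lemma mem_all_zsf l (S : {mset 'Z_n}%mset) : S \in all_zsf l <-> size S = l /\ zsf (S : seq 'Z_n).
Proof.
rewrite /all_zsf in_fset_set; last exact: finite_zero_sum_free_in.
rewrite inE; split=> [[? /zero_sum_freeP ? _] //|[? ?]]; split=> //.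
  exact/zero_sum_freeP.
by move=> x _; rewrite inE.
Qed.

(** By [zsf_structure] a generator and a tuple of coefficients determine the sequence. *)
Lemma card_all_zsf k : ((8 * k).+2 <= n)%N ->
  (#|` all_zsf (n - 1 - k)| <= num_generators n * (3 * k).+2 ^ k.*2)%N.
Proof.
move=> kn; pose f (gt : 'Z_n * (k.*2).-tuple 'I_(3 * k).+2) :=
  seq_mset (nseq (n - 1 - k - k.*2) gt.1 ++ [seq gt.1 *+ i | i : 'I_(3 * k).+2 <- gt.2]).
pose D := finset.setX [set g : 'Z_n | generator [set: 'Z_n]%SET g]%SET [set: (k.*2).-tuple 'I_(3 * k).+2]%SET.
have -> : (num_generators n * (3 * k).+2 ^ k.*2 = #|D|)%N.
  by rewrite cardsX cardsT card_tuple card_ord.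
suff sub : (all_zsf (n - 1 - k) `<=` [fset f gt | gt in D])%fset.
  apply: leq_trans (fsubset_leq_card sub) _.
  by apply: leq_trans (leq_imfset_card _ _ _) _; rewrite cardE.
apply/fsubsetP => S /mem_all_zsf[sS zS].
have [g [t [gg p]]] := zsf_structure kn sS zS.
apply/imfsetP; exists (g, t) => /=; first by rewrite !inE gg.
by rewrite -[LHS]seq_mset_id; apply/eq_seq_msetP.
Qed.

Definition supp (S : {mset 'Z_n}%mset) : {set 'Z_n} := [set x in (S : seq 'Z_n)]%SET.

(** These sequences are the constant ones: [g] repeated [l] times is zero-sum free exactly when [g]
    generates, because [n <= 2l] and [l < n]. *)
Lemma card_supp1 k : ((8 * k).+2 <= n)%N ->
  #|` [fset S in all_zsf (n - 1 - k) | #|supp S| == 1]%fset| = num_generators n.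
Proof.
move=> kn; set l := (n - 1 - k)%N; have l0 : (0 < l)%N by lia.
pose G := [set g : 'Z_n | generator [set: 'Z_n]%SET g]%SET.
have -> : [fset S in all_zsf l | #|supp S| == 1]%fset =
    [fset msetn l g | g in G]%fset.
  apply/fsetP => /= S; rewrite !inE /=; apply/andP/imfsetP => /=.
    move=> [/mem_all_zsf[sS zS] /cards1P[g Sg]].
    have SE : (S : {mset 'Z_n}%mset) = nseq l g :> seq _.
      rewrite -sS; apply/all_pred1P/allP => x xS /=.
      have : x \in supp S by rewrite inE.
      by rewrite Sg inE.
    exists g; last by rewrite -[LHS]seq_mset_id SE -(enum_msetn l g) seq_mset_id.
    rewrite inE; apply: (@zsf_generator _ l); last by rewrite -SE.
    by rewrite /l; lia.
  move=> [g]; rewrite inE => gg ->; split.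
    apply/mem_all_zsf; rewrite enum_msetn size_nseq; split=> //.
    by apply: generator_zsf => //; lia.
  apply/cards1P; exists g; apply/setP => x; rewrite !inE.
  by rewrite -msuppE finsupp_msetn l0 inE.
by rewrite card_imfset /= -?cardE //; exact: msetn_inj.
Qed.

End CyclicStructure.

(** A sum of indicators over an index set independent of [A] is the form to which linearity of
    expectation applies. *)
Lemma num_zero_sum_freeE n l (A : {set 'Z_n}) :
  num_zero_sum_free l A = (\sum_(S <- all_zsf n l) (supp S \subset A)%SET)%N.
Proof.
rewrite -big_mkcond /= sum1_count -size_filter.
apply: perm_size; apply: uniq_perm; rewrite ?fset_uniq ?filter_uniq ?fset_uniq //.
move=> /= S; rewrite mem_filter in_fset_set; last exact: finite_zero_sum_free_in.
apply/idP/andP; rewrite inE.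
  move=> [sS /zero_sum_freeP zS SA]; split; last exact/mem_all_zsf.
  by apply/fintype.subsetP => x; rewrite inE; exact: SA.
move=> [/fintype.subsetP SA /mem_all_zsf[sS zS]]; split=> //.
  exact/zero_sum_freeP.
by move=> x xS; apply: SA; rewrite inE.
Qed.

(** * The expectation as a sum of powers of [p] *)

Section ExpectedNumber.
Context d (Om : measurableType d) (R : realType) (P : probability Om R).
Variables (n : nat) (p : R) (X : Om -> {set 'Z_n}).
Hypothesis Xp : random_subset P p X.

Lemma random_subset_superset (J : {set 'Z_n}) :
  measurable [set w | (J \subset X w)%SET] /\
  P [set w | (J \subset X w)%SET] = (p ^+ #|J|)%:E.
Proof.
have [[mX indX] pX] := Xp.
have -> : [set w | (J \subset X w)%SET] =
    \bigcap_(i in [set` J]) [set w | i \in X w].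
  by apply/seteqP; split => w /=; [move/fintype.subsetP | move=> JX; apply/fintype.subsetP].
split; last first.
  rewrite indX (eq_bigr (fun=> p%:E)); last by move=> i _; exact: pX.
  by rewrite prodEFin prodr_const.
apply: fin_bigcap_measurable => // i _; exact: mX.
Qed.

Lemma random_subset_proba_ge0 : 0 <= p.
Proof. by rewrite -lee_fin -((Xp.2) 0) measure_ge0. Qed.

Lemma random_subset_proba_le1 : p <= 1.
Proof.
by rewrite -lee_fin -((Xp.2) 0) probability_le1 //; have [[]] := Xp.
Qed.

Lemma expectation_num_zero_sum_free l :
  ('E_P[fun w => (num_zero_sum_free l (X w))%:R] =
   (\sum_(S <- all_zsf n l) p ^+ #|supp S|)%:E)%E.
Proof.
rewrite unlock.
under eq_integral => w _.
  rewrite num_zero_sum_freeE natr_sum -sumEFin.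
  over.
rewrite ge0_integral_sum //=.
- rewrite -sumEFin; apply: eq_bigr => S _; have [mS PS] := random_subset_superset (supp S).
  rewrite -PS; transitivity (\int[P]_(w in setT) (\1_[set w | (supp S \subset X w)%SET] w)%:E)%E.
    by apply: eq_integral => w _; rewrite indicE mem_setE.
  by rewrite integral_indic // setIT.
- move=> S; have [mS PS] := random_subset_superset (supp S).
  apply/measurable_EFinP; rewrite (_ : (fun _ => _) = \1_[set w | (supp S \subset X w)%SET]).
    exact: measurable_indic.
  by apply/funext => w; rewrite indicE mem_setE.
Qed.
End ExpectedNumber.

(** * Main term and error term *)

Theorem corollary3 (R : realType) (k : nat) :
  exists C : R, forall (p : nat -> R)
      (d : nat -> measure_display) (Om : forall n : nat, measurableType (d n))
      (P : forall n : nat, probability (Om n) R)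
      (X : forall n : nat, Om n -> {set 'Z_n}),
    p @ \oo --> (0 : R) ->
    (forall n : nat, (1 < n)%N -> random_subset (P n) (p n) (@X n)) ->
    exists delta : nat -> R,
      \forall n \near \oo,
        ('E_(P n)[fun w => (num_zero_sum_free (n - 1 - k) (X n w))%:R]
           = (p n * (num_generators n)%:R * (1 + delta n))%:E)%E
        /\ `|delta n| <= C * p n.
Proof.
(* The number of coefficient tuples per generator in [card_all_zsf]. *)
exists ((3 * k).+2 ^ k.*2)%:R => p d Om P X _ Xp.
pose rest n := \sum_(S <- all_zsf n (n - 1 - k) | #|supp S| != 1%N) p n ^+ #|supp S|.
(* [delta] is the contribution of the non-constant sequences relative to the main term. *)
exists (fun n => rest n / (p n * (num_generators n)%:R)).
exists ((8 * k).+2) => // n /= kn.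
have n_gt1 : (1 < n)%N by lia.
have {}Xp := Xp n n_gt1.
have p0 := random_subset_proba_ge0 Xp; have p1 := random_subset_proba_le1 Xp.
set phi := num_generators n.
have card_le := card_all_zsf n_gt1 kn; rewrite -/phi in card_le.
have phi0 : (0 < phi)%N.
  by apply/card_gt0P; exists 1; rewrite inE; apply/eqP; exact: Zp_cycle.
have main : \sum_(S <- all_zsf n (n - 1 - k) | #|supp S| == 1%N) p n ^+ #|supp S|
    = p n * phi%:R.
  rewrite (eq_bigr (fun=> p n)); last by move=> S /eqP ->.
  rewrite big_const_seq iter_addr_0 mulr_natr; congr (_ *+ _).
  rewrite /phi -(card_supp1 n_gt1 kn) -size_filter.
  by apply: perm_size; apply: uniq_perm; rewrite ?fset_uniq ?filter_uniq ?fset_uniq // => S;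
    rewrite mem_filter !inE andbC.
have supp_ge2 S : S \in all_zsf n (n - 1 - k) -> #|supp S| != 1%N -> (2 <= #|supp S|)%N.
  move=> /mem_all_zsf[sS _]; have [S0|[x xS]] := mset_0Vmem S.
    by move: sS; rewrite S0 size_mset0; lia.
  have : (0 < #|supp S|)%N by apply/card_gt0P; exists x; rewrite inE.
  by case: #|supp S| => [|[]].
have rest0 : 0 <= rest n by apply: sumr_ge0 => S _; exact: exprn_ge0.
have rest_le : rest n <= (phi * (3 * k).+2 ^ k.*2)%:R * p n ^+ 2.
  apply: (@le_trans _ _ (\sum_(S <- all_zsf n (n - 1 - k)) p n ^+ 2)).
    rewrite /rest big_mkcond /= big_seq [leRHS]big_seq; apply: ler_sum => S SF.
    case: ifPn => S1; last exact: exprn_ge0.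
    (* Since [0 <= p n <= 1], a support of size at least 2 contributes at most the square of
       [p n]. *)
    by apply: ler_wiXn2l => //; exact: supp_ge2.
  rewrite big_const_seq iter_addr_0 count_predT -[leLHS]mulr_natl.
  by rewrite ler_wpM2r ?exprn_ge0 // ler_nat.
rewrite (expectation_num_zero_sum_free Xp) (bigID (fun S => #|supp S| == 1%N)) /= main.
rewrite -/(rest n).
have phiR : (0 : R) < phi%:R by rewrite ltr0n.
(* If [p n = 0], the denominator of [delta n] vanishes, but so does [rest n]; then [delta n = 0] and
   both claims are trivial. *)
have [pn0|pn0] := eqVneq (p n) 0.
  have r0 : rest n = 0 by apply/eqP; rewrite eq_le rest0 (le_trans rest_le) // pn0 expr0n mulr0.
  by rewrite r0 pn0 !mul0r normr0 addr0 mulr0.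
have pgt : 0 < p n by rewrite lt_def pn0.
split.
  by rewrite mulrDr mulr1 mulrCA mulfV ?mulr1 // mulf_neq0 // gt_eqF.
rewrite ger0_norm; last by rewrite divr_ge0 // mulr_ge0.
rewrite ler_pdivrMr ?mulr_gt0 // (le_trans rest_le) // natrM expr2.
by rewrite le_eqVlt; apply/orP; left; apply/eqP; ring.
Qed.
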